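(* Let $w\in A^{1,1}(\mathbb D)$, $w(z)=\sum_{k\ge0}c_kz^k$, $L_w=\sum_{k\ge1}k|c_k|$, let $Q\in(0,\|w\|_\infty)$ be a peripheral threshold of $w$, and fix $M_0\ge1$. Set $$E_+=E(w,Q),\qquad E_-:=\{\xi\in E_+:\ b_w(\xi)<Q\},\qquad A=M_0L_w\max_{\xi\in E_+}\operatorname{ord}(\xi).$$ Let $C_+$ be the constant $$C_+=M_0+(1+M_0)M_0L_w\max\Big\{\frac{2\pi}{a-Q},\frac{2N}{g}\Big\}$$ formed with any admissible scalar data $(a,N,g)$ at level $Q$ (defined in the context). Then there exists $q_0<Q$ such that $E(w,q)=E_-$ for $q_0\le q<Q$ and such that, for every power bounded operator $T$ on a complex Banach space satisfying $$M(T)\le M_0,\qquad\sup_{n\ge1}\|w(T^n)\|\le q,\qquad q_0\le q<Q,$$ the following estimates hold: (i) If $E_-\ne\emptyset$, then $\displaystyle K_{E_-}(T)\le\frac{6AC_+}{Q-q}$. (ii) If $E_-=\emptyset$, then $$\sup_{|\lambda|\ge1}\|(\lambda-T)^{-1}\|\le\frac{2AC_+}{Q-q},\qquad r(T)\le1-\frac{Q-q}{2AC_+}.$$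
   Context: $\mathbb D$ is the open unit disc, $\mathbb T$ the unit circle, $r(T)$ the spectral radius. $M(T):=\sup_{n\ge0}\|T^n\|$. $A^{1,1}(\mathbb D)$ is the algebra of functions $w(z)=\sum_{k\ge0}c_kz^k$ with $\sum_k(k+1)|c_k|<\infty$; $\|w\|_\infty:=\max_{\mathbb T}|w|$; $w(S):=\sum_kc_kS^k$ for power bounded $S$. For $q<\|w\|_\infty$, $E(w,q):=\{\lambda\in\mathbb T:\sup_{n\ge1}|w(\lambda^n)|\le q\}$, which is a finite set of roots of unity. $\operatorname{ord}(\xi)$ is the order of a root of unity $\xi$, and $b_w(\xi):=\max_{1\le n\le\operatorname{ord}(\xi)}|w(\xi^n)|$. A number $Q\in(0,\|w\|_\infty)$ is a peripheral threshold of $w$ if $b_w(\xi)=Q$ for some root of unity $\xi$. For a finite nonempty $E\subset\mathbb T$, $K_E(T):=\sup_{|\lambda|>1}\operatorname{dist}(\lambda,E)\,\|(\lambda-T)^{-1}\|$. Admissible scalar data at level $Q$: choose a closed arc $\Gamma\subset\mathbb T$ of angular length $\ell>0$ and $a>Q$ with $\min_{\eta\in\Gamma}|w(\eta)|\ge a$; put $D=\max_{\xi\in E_+}\operatorname{ord}(\xi)$, let $U$ be the union of the open angular neighbourhoods of radius $\ell/(2D)$ about the points of $E_+$ (angular distance on $\mathbb T$ taking values in $[0,\pi]$), and $F_0=\mathbb T\setminus U$; if $F_0\neq\emptyset$, choose $N\ge1$ such that $g:=\min_{\eta\in F_0}\max_{1\le n\le N}|w(\eta^n)|-Q>0$ (such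 $N$ exists). If $F_0=\emptyset$, the term $2N/g$ is omitted from the maximum defining $C_+$. *)

(* Defs.v *)
From HB Require Import structures.
From mathcomp Require Import all_boot all_order all_algebra finmap.
From mathcomp Require Import all_classical all_reals all_analysis.
From mathcomp Require Import complex.

Set Implicit Arguments.
Unset Strict Implicit.
Unset Printing Implicit Defensive.

Import Order.TTheory GRing.Theory Num.Theory numFieldNormedType.Exports.
Local Open Scope classical_set_scope.
Local Open Scope ring_scope.
Local Open Scope complex_scope.

(* The field of scalars is R[i] with R : realType.  A norm over R[i] takes its
   values in R[i] (they are nonnegative, hence real); rnorm is the same norm
   seen in R.  It applies to scalars and to vectors alike. *)
Definition rnorm (R : realType) (V : normedZmodType R[i]) (x : V) : R :=
  complex.Re `|x|.

Section Circle.
Variable R : realType.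
Implicit Types (z lambda xi eta : R[i]) (E : set R[i]).

Definition unit_circle : set R[i] := [set z | rnorm z = 1].

Definition expi (t : R) : R[i] := cos t +i* sin t.

(* A closed arc of angular length l starting at the angle t0. *)
Definition arc (t0 l : R) : set R[i] := [set expi (t0 + t) | t in `[0, l]].

(* For eta, xi on the unit circle, eta / xi = expi t for a t in ]-pi, pi]; this
   is |t|. *)
Definition angdist eta xi : R := acos (complex.Re (eta / xi)).

Definition root_of_unity xi : Prop := exists2 n, (0 < n)%N & xi ^+ n = 1.

(* The order of a root of unity; 0 if xi is not a root of unity. *)
Definition ord xi : nat := xget 0%N [set n | n.-primitive_root xi].

(* The largest order of a point of E, for E a finite set. *)
Definition max_ord E : nat := (\max_(xi <- fset_set E) ord xi)%N.

Definition dist lambda E : R := inf [set rnorm (lambda - xi) | xi in E].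

End Circle.

(* A function w(z) = sum_k c_k z^k is given by its sequence c of Taylor
   coefficients. *)
Section Scalar.
Variables (R : realType) (c : nat -> R[i]).
Implicit Types (z lambda xi eta : R[i]).

Definition A11 : Prop := cvgn (series (fun k => k.+1%:R * rnorm (c k) : R)).

Definition eval z : R[i] := limn (fun n => \sum_(k < n) c k * z ^+ k : R[i]^o).

Definition normoo : R := sup [set rnorm (eval z) | z in @unit_circle R].

Definition Lw : R := limn (fun n => \sum_(1 <= k < n) k%:R * rnorm (c k) : R).

(* max_(1 <= n <= N) |w(z^n)|, for N >= 1 *)
Definition maxpow (N : nat) z : R :=
  \big[Num.max/0]_(1 <= n < N.+1) rnorm (eval (z ^+ n)).

Definition bw xi : R := maxpow (ord xi) xi.

Definition Eset (q : R) : set R[i] :=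
  [set lambda | unit_circle lambda /\
    sup [set rnorm (eval (lambda ^+ n)) | n in [set n | (1 <= n)%N]] <= q].

Definition Eminus (Q : R) : set R[i] := [set xi | Eset Q xi /\ bw xi < Q].

Definition peripheral_threshold (Q : R) : Prop :=
  0 < Q < normoo /\ exists2 xi, root_of_unity xi & bw xi = Q.

Definition Uset (Q l : R) : set R[i] :=
  [set eta | unit_circle eta /\ exists2 xi, Eset Q xi &
    angdist eta xi < l / (2 * (max_ord (Eset Q))%:R)].

Definition F0 (Q l : R) : set R[i] := @unit_circle R `\` Uset Q l.

Definition gap (Q l : R) (N : nat) : R :=
  inf [set maxpow N eta | eta in F0 Q l] - Q.

(* The arc is given by its starting angle t0 and its length l.  When F0 is
   empty, N is not constrained, and it does not occur in Cplus. *)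
Definition admissible (Q t0 l a : R) (N : nat) : Prop :=
  [/\ 0 < l <= 2 * pi,
      Q < a,
      forall eta, arc t0 l eta -> a <= rnorm (eval eta) &
      F0 Q l !=set0 -> (1 <= N)%N /\ 0 < gap Q l N].

Definition Cplus (Q M0 l a : R) (N : nat) : R :=
  M0 + (1 + M0) * M0 * Lw *
    (if `[< F0 Q l = set0 >] then 2 * pi / (a - Q)
     else Num.max (2 * pi / (a - Q)) (2 * N%:R / gap Q l N)).

End Scalar.

(* Suprema of operator norms are taken in the extended reals, so that a bound
   by a real number includes finiteness. *)
Section Operators.
Variables (R : realType) (X : completeNormedModType R[i]).
Implicit Types (T S : X -> X) (lambda : R[i]) (E : set R[i]).

Definition opnorm S : \bar R :=
  ereal_sup [set (rnorm (S x))%:E | x in [set x : X | rnorm x <= 1]].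

Definition power_sup T : \bar R :=
  ereal_sup [set opnorm (iter n T) | n in [set: nat]].

Definition power_bounded T : Prop := (power_sup T < +oo)%E.

(* w(S), for S power bounded and sum_k |c_k| finite: the series of operators
   then converges absolutely in operator norm, and its sum is the pointwise
   one. *)
Definition opeval (c : nat -> R[i]) S : X -> X :=
  fun x => limn (fun n => \sum_(k < n) c k *: iter k S x).

Definition resolvent_set T : set R[i] :=
  [set lambda | exists S : {linear X -> X}, [/\ continuous S,
     forall x, S (lambda *: x - T x) = x &
     forall x, lambda *: S x - T (S x) = x]].

Definition spectrum T : set R[i] := ~` resolvent_set T.

(* The inverse function of lambda - T, for lambda in the resolvent set. *)
Definition resolvent T lambda : X -> X :=
  fun y => xget 0 [set x | lambda *: x - T x = y].

(* The norm of (lambda - T)^-1, infinite on the spectrum. *)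
Definition resolvent_norm T lambda : \bar R :=
  if `[< resolvent_set T lambda >] then opnorm (resolvent T lambda) else +oo%E.

(* The spectrum of a bounded operator is bounded, and nonempty unless X is the
   zero space, for which this supremum is 0. *)
Definition spectral_radius T : R :=
  sup [set rnorm lambda | lambda in spectrum T].

Definition KE E T : \bar R :=
  ereal_sup [set ((dist lambda E)%:E * resolvent_norm T lambda)%E
            | lambda in [set lambda : R[i] | 1 < rnorm lambda]].

End Operators.

(* Main.v *)
Require Import Defs.
From HB Require Import structures.
From mathcomp Require Import all_boot all_order all_algebra finmap.
From mathcomp Require Import all_classical all_reals all_analysis.
From mathcomp Require Import complex.
From mathcomp Require Import ring lra.

Set Implicit Arguments.
Unset Strict Implicit.
Unset Printing Implicit Defensive.

Import Order.TTheory GRing.Theory Num.Theory numFieldNormedType.Exports.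
Local Open Scope classical_set_scope.
Local Open Scope ring_scope.
Local Open Scope complex_scope.

(** The operator enters only through lower bounds for [lambda x - T x], and
    these come from the powers of [lambda].  Let [|lambda| = 1] and
    [y = lambda x - T x].  The vector [w(lambda^n) x - w(T^n) x] is the sum of
    the [c_k (lambda^(nk) - T^(nk)) x], and telescoping bounds the [k]-th term
    by [|c_k| n k M0 |y|]; as [w(T^n)] has norm at most [q],
      [(|w(lambda^n)| - q) |x| <= n M0 L_w |y|]
    ([calculus_lower_bound]).  So [lambda - T] is well bounded below as soon as
    [|w|] exceeds [q] at an early power of [lambda].

    The scalar heart is that a point [eta] of the circle at distance [s > 0] from
    [E_+ = E(w, Q)] has a power [eta^n], with [n] of order [1 / s], at which
    [|w|] is above [Q] by a fixed amount ([power_separation]).  If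
    [eta = xi e^(it)] is close to some [xi] in [E_+] of order [d], then the
    powers [eta^(kd) = e^(ikdt)] walk round the circle from 1 in steps shorter
    than [Gamma].  This arc does not contain 1, because [|w(1)| <= Q], so the
    walk meets it during its first turn: [kd <= 2 pi / |t|].  If [eta] is close
    to no such point, the gap condition provides some [n <= N].  The same walk,
    with a pigeonhole argument, shows that [E_+] is a finite set of roots of
    unity.  Together with the elementary bound
    [(|lambda| - 1) |x| <= M0 |lambda x - T x|] outside the disc, this gives,
    for [|lambda| >= 1], a point [xi] of [E_+] with
    [|lambda - xi| |x| <= C_+ |lambda x - T x|] ([exterior_lower_bound]).

    If [xi] is in [E_+] but not in [E_-], then [|w(xi^n)| = Q] for some
    [n <= ord xi], and [calculus_lower_bound] yields
    [(Q - q) |x| <= A |xi x - T x|]; half of this survives within distance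
    [(Q - q) / 2A] of [xi] ([near_peak_lower_bound]).  Farther away the bound
    with [C_+] applies with [|lambda - xi| >= (Q - q) / 2A].  The two cases give
    [2 A C_+ / (Q - q)], and replacing the distance to [xi] by the distance to
    [E_-], which is larger by at most 2, gives [6 A C_+ / (Q - q)].  The
    threshold [q0] only has to dominate [b_w] on the finite set [E_-] and to
    ensure [Q - q <= 2 A].

    Lower bounds become resolvent bounds by perturbation: the exterior of the
    closed disc lies in the resolvent set, and a point of the resolvent set where
    [lambda - T] is bounded below by [1 / kappa] brings with it the open disc of
    radius [1 / kappa] ([resolvent_open]).  Applied from outside, this reaches the unit
    circle; applied from the circle, it reaches an annulus of width
    [1 / kappa] inside, whence the bound for the spectral radius. *)

(** * The real-valued norm *)

Section RealNorm.
Variables (R : realType) (V : normedZmodType R[i]).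
Implicit Types (x y : V).

Lemma normE x : `|x| = (rnorm x)%:C.
Proof.
rewrite /rnorm; have := normr_ge0 x; rewrite lecE => /andP[/eqP + _].
by case: `|x| => a b /= ->.
Qed.

Lemma rnorm_ge0 x : 0 <= rnorm x.
Proof. by have := normr_ge0 x; rewrite normE lecR. Qed.

Lemma rnorm0 : rnorm (0 : V) = 0.
Proof. by rewrite /rnorm normr0. Qed.

Lemma rnorm_eq0 x : (rnorm x == 0) = (x == 0).
Proof. by rewrite -(normr_eq0 x) normE -(inj_eq (@complexI R)). Qed.

Lemma rnorm_gt0 x : (0 < rnorm x) = (x != 0).
Proof. by rewrite lt_def rnorm_eq0 rnorm_ge0 andbT. Qed.

Lemma rnormN x : rnorm (- x) = rnorm x.
Proof. by rewrite /rnorm normrN. Qed.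

Lemma rnormB x y : rnorm (x - y) = rnorm (y - x).
Proof. by rewrite /rnorm distrC. Qed.

Lemma rnormD x y : rnorm (x + y) <= rnorm x + rnorm y.
Proof. by rewrite -lecR rmorphD /= -!normE ler_normD. Qed.

Lemma rnorm_leB x y : rnorm x - rnorm y <= rnorm (x - y).
Proof. by rewrite lerBlDr; have := rnormD (x - y) y; rewrite subrK. Qed.

Lemma rnorm_sum (I : Type) (r : seq I) (P : pred I) (u : I -> V) :
  rnorm (\sum_(i <- r | P i) u i) <= \sum_(i <- r | P i) rnorm (u i).
Proof.
elim/big_ind2: _ => [|x1 x2 y1 y2 h1 h2|//]; first by rewrite rnorm0.
by apply: le_trans (rnormD _ _) _; exact: lerD.
Qed.

End RealNorm.

Section ScalarNorm.
Variable R : realType.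
Implicit Types (z : R[i]).

Lemma rnormM z1 z2 : rnorm (z1 * z2) = rnorm z1 * rnorm z2.
Proof.
by apply: (@complexI R); rewrite rmorphM /= -!normE normrM.
Qed.

Lemma rnorm1 : rnorm (1 : R[i]) = 1.
Proof. by rewrite /rnorm normr1. Qed.

Lemma rnormX z n : rnorm (z ^+ n) = rnorm z ^+ n.
Proof.
by elim: n => [|n IH]; rewrite ?expr0 ?rnorm1// !exprS rnormM IH.
Qed.

Lemma rnormV z : rnorm z^-1 = (rnorm z)^-1.
Proof.
by apply: (@complexI R); rewrite fmorphV /= -!normE normfV.
Qed.

Lemma rnormC (r : R) : rnorm (r%:C : R[i]) = `|r|.
Proof. by rewrite /rnorm normc_def /= expr0n /= addr0 sqrtr_sqr. Qed.

Lemma sqr_rnorm z : rnorm z ^+ 2 = complex.Re z ^+ 2 + complex.Im z ^+ 2.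
Proof.
by rewrite /rnorm normc_def /= sqr_sqrtr // addr_ge0 ?sqr_ge0.
Qed.

Lemma Re_le_rnorm z : `|complex.Re z| <= rnorm z.
Proof. by have := normc_ge_Re z; rewrite normE lecR. Qed.

Lemma Im_le_rnorm z : `|complex.Im z| <= rnorm z.
Proof.
rewrite -(@ler_pXn2r _ 2) ?nnegrE ?rnorm_ge0// sqr_rnorm real_normK ?num_real//.
by rewrite lerDr sqr_ge0.
Qed.

Lemma rnorm_le_ReIm z : rnorm z <= `|complex.Re z| + `|complex.Im z|.
Proof.
rewrite -(@ler_pXn2r _ 2) ?nnegrE ?rnorm_ge0 ?addr_ge0// sqr_rnorm.
rewrite sqrrD !real_normK ?num_real// lerD2r lerDl.
by rewrite mulrn_wge0// mulr_ge0.
Qed.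

End ScalarNorm.

Lemma rnormZ (R : realType) (V : normedModType R[i]) (a : R[i]) (x : V) :
  rnorm (a *: x) = rnorm a * rnorm x.
Proof.
by apply: (@complexI R); rewrite rmorphM /= -!normE normrZ.
Qed.

(** * Convergence in normed spaces over the complex numbers *)

Section RealCvg.
Variables (R : realType) (V : normedModType R[i]).

Lemma gt0_complexP (e : R[i]) : 0 < e -> exists2 r : R, 0 < r & e = r%:C.
Proof.
by case: e => a b; rewrite ltcE /= => /andP[/eqP -> a0]; exists a.
Qed.

Lemma cvg_rnormP (T : Type) (F : set_system T) (FF : Filter F) (f : T -> V)
    (y : V) :
  f x @[x --> F] --> y <->
  (forall e : R, 0 < e -> \forall x \near F, rnorm (y - f x) < e).
Proof.
split=> [/cvgrPdist_lt h e e0|h].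
  by apply: filterS (h e%:C _); rewrite ?ltcR// => x; rewrite normE ltcR.
apply/cvgrPdist_lt => _ /gt0_complexP[r r0 ->].
by apply: filterS (h r r0) => x; rewrite normE ltcR.
Qed.

Lemma rnorm_lim_le (u : nat -> V) (y : V) (b : R) :
  u @ \oo --> y -> (forall n, rnorm (u n) <= b) -> rnorm y <= b.
Proof.
move=> /cvg_rnormP h ub; apply/ler_addgt0Pr => e e0.
have [n /= hn] := @filter_ex _ _ _ _ (h e e0).
have := rnorm_leB y (u n); have := ub n; lra.
Qed.

End RealCvg.

(** The real and imaginary parts of a Cauchy filter are Cauchy filters of
    reals. *)
Lemma complex_complete (R : realType) (F : set_system (R[i]^o)) :
  ProperFilter F -> cauchy F -> cvg F.
Proof.
move=> FF /cauchy_ballP Fc.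
have part (f : R[i]^o -> R) : (forall y z, `|f y - f z| <= rnorm (y - z)) ->
    cvg (f @ F).
  move=> flip; apply: cauchy_cvg; apply/cauchy_ballP => e e0.
  have eC0 : 0 < e%:C :> R[i] by rewrite ltcR.
  have /= := Fc _ eC0.
  rewrite !near_simpl; apply: filter_app; near=> z => /=.
  rewrite -!ball_normE /= normE ltcR; exact: le_lt_trans (flip _ _).
have cRe : cvg ((@complex.Re R : R[i]^o -> R) @ F).
  by apply: part => y z; rewrite -raddfB; exact: Re_le_rnorm.
have cIm : cvg ((@complex.Im R : R[i]^o -> R) @ F).
  by apply: part => y z; rewrite -raddfB; exact: Im_le_rnorm.
apply/cvg_ex; exists ((lim ((@complex.Re R : R[i]^o -> R) @ F)) +i*
  (lim ((@complex.Im R : R[i]^o -> R) @ F))).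
apply/(@cvg_rnormP R R[i]^o R[i]^o F _ id) => e e0.
have e20 : 0 < e / 2 by rewrite divr_gt0.
move/cvgrPdist_lt: cRe => /(_ _ e20) hRe.
move/cvgrPdist_lt: cIm => /(_ _ e20) hIm.
near=> z.
apply: le_lt_trans (rnorm_le_ReIm _) _; rewrite !raddfB /= [ltRHS](splitr e).
by apply: ltrD; near: z.
Unshelve. all: by end_near. Qed.

(** Completeness is a hypothesis on [V], rather than part of its type, so that
    the lemma applies both to Banach spaces and to the scalars [R[i]^o]. *)
Lemma abs_series_cvg (R : realType) (V : normedModType R[i])
    (u : nat -> V) (b : nat -> R) :
  (forall F : set_system V, ProperFilter F -> cauchy F -> cvg F) ->
  (forall k, rnorm (u k) <= b k) -> cvgn (series b) ->
  cvgn (fun n => \sum_(k < n) u k).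
Proof.
move=> Vcomplete ub bc.
rewrite (_ : (fun n => _) = series u); last first.
  by apply/funext => n; rewrite /series /= big_mkord.
apply: Vcomplete; apply/cauchy_seriesP => _ /gt0_complexP[r r0 ->].
move/cauchy_cvgP/cauchy_seriesP: bc => /(_ r r0); apply: filterS => n /=.
rewrite normE ltcR; apply: le_lt_trans; apply: le_trans (rnorm_sum _ _ _) _.
by apply: le_trans (ler_norm _); exact: ler_sum.
Qed.

(** * Angles and returns to an arc *)

Section Angles.
Variable R : realType.
Implicit Types (s t x : R) (z xi eta : R[i]).

Lemma sin_le_norm x : `|sin x| <= `|x|.
Proof.
have pos (y : R) : 0 <= y -> `|sin y| <= y.
  move=> y0.
  have [|z _] := @MVT_segment R sin cos 0 y y0.
    by apply: continuous_subspaceT => z; exact: continuous_sin.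
  rewrite sin0 !subr0 => ->; rewrite normrM (ger0_norm y0).
  by rewrite ler_piMl// cos_max.
have [x0|x0] := leP 0 x; first by rewrite (ger0_norm x0); exact: pos.
by rewrite -(normrN (sin x)) -sinN (ltr0_norm x0); apply: pos; rewrite oppr_ge0 ltW.
Qed.

Lemma expi0 : expi 0 = 1 :> R[i].
Proof. by rewrite /expi cos0 sin0. Qed.

Lemma expiD s t : expi (s + t) = expi s * expi t :> R[i].
Proof. by rewrite /expi cosD sinD; apply/eqP; rewrite eq_complex /= addrC eqxx
  [sin s * _ + _]addrC eqxx. Qed.

Lemma expiX t n : expi t ^+ n = expi (n%:R * t) :> R[i].
Proof.
elim: n => [|n IH]; first by rewrite mul0r expi0 expr0.
by rewrite exprS IH -expiD -natr1 mulrDl mul1r addrC.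
Qed.

Lemma expi_eqN s t : expi s = expi t :> R[i] -> expi (- s) = expi (- t) :> R[i].
Proof. by rewrite /expi !cosN !sinN => -[-> ->]. Qed.

Lemma expiB2pi t (k : nat) : expi (t - k%:R * (2 * pi)) = expi t :> R[i].
Proof.
rewrite expiD -mulrN -expiX.
suff -> : expi (- (2 * pi)) = 1 :> R[i] by rewrite expr1n mulr1.
by rewrite /expi cosN sinN mulr_natl cos2pi sin2pi oppr0.
Qed.

Lemma Re_circle z : rnorm z = 1 -> -1 <= complex.Re z <= 1.
Proof. by move=> z1; rewrite -ler_norml -z1 Re_le_rnorm. Qed.

(** The angle in [ [-pi, pi] ] whose absolute value is the angular distance to
    1. *)
Lemma circle_expi z : rnorm z = 1 ->
  exists2 t, `|t| = acos (complex.Re z) & z = expi t.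
Proof.
move=> z1; have zR := Re_circle z1.
have E : complex.Im z ^+ 2 = sin (acos (complex.Re z)) ^+ 2.
  rewrite sin2cos2 acosK ?in_itv//=; apply/eqP.
  by rewrite eq_sym subr_eq addrC -sqr_rnorm z1 expr1n.
have a0 := acos_ge0 zR.
case/eqP: E; rewrite -subr_eq0 subr_sqr mulf_eq0 => /orP[]/eqP E.
  exists (acos (complex.Re z)); first by rewrite ger0_norm.
  rewrite /expi acosK ?in_itv//=; move: E => /eqP; rewrite subr_eq0 => /eqP <-.
  by case: (z).
exists (- acos (complex.Re z)); first by rewrite normrN ger0_norm.
rewrite /expi cosN sinN acosK ?in_itv//=.
by move: E => /eqP; rewrite addr_eq0 => /eqP <-; case: (z).
Qed.

Lemma circle_expi_2pi z : rnorm z = 1 ->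
  exists2 t, 0 <= t < 2 * pi & z = expi t.
Proof.
move=> z1; have [t tE ->] := circle_expi z1.
have := acos_lepi (Re_circle z1); rewrite -tE => tpi.
have p0 := pi_gt0 R.
have [t0|t0] := leP 0 t.
  exists t => //; rewrite t0 /=; have := ger0_norm t0; lra.
exists (t + 2 * pi).
  by have := ltr0_norm t0; move=> ?; apply/andP; split; lra.
by rewrite -[in RHS](expiB2pi _ 1) mul1r addrK.
Qed.

(** A chord is shorter than its arc: with [s = sin (t / 2)], the square of the
    chord is [4 s^2]. *)
Lemma rnorm_expiB1 t : rnorm (expi t - 1 : R[i]) <= `|t|.
Proof.
rewrite -(@ler_pXn2r _ 2) ?nnegrE ?rnorm_ge0// sqr_rnorm /= subr0.
have -> : cos t = cos ((t / 2) *+ 2) by rewrite -mulr_natr divfK.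
have -> : sin t = sin ((t / 2) *+ 2) by rewrite -mulr_natr divfK.
have : sin (t / 2) ^+ 2 <= (t / 2) ^+ 2.
  rewrite -real_normK ?num_real// -[leRHS]real_normK ?num_real//.
  by rewrite ler_pXn2r ?nnegrE ?normr_ge0// sin_le_norm.
rewrite real_normK ?num_real// => h.
have -> (u v : R) : (u - 1) ^+ 2 + v ^+ 2 = (u ^+ 2 + v ^+ 2) + 1 - 2 * u by ring.
rewrite cos2Dsin2 cos_mulr2n cos2sin2 mulr2n.
rewrite exprMn exprVn in h; lra.
Qed.

Lemma rnorm_rotation xi t : rnorm xi = 1 -> rnorm (xi * expi t - xi) <= `|t|.
Proof.
by move=> xi1; rewrite -{2}(mulr1 xi) -mulrBr rnormM xi1 mul1r rnorm_expiB1.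
Qed.

(** The multiples of [phi] advance in steps no longer than the arc, so that the
    first one beyond its initial angle is in it.  As 1 is outside the arc, the
    arc does not straddle the angle [2 pi], and it is met during the first
    turn. *)
Lemma return_to_arc_pos (t0 l phi : R) : 0 < phi <= l -> ~ Defs.arc t0 l 1 ->
  exists k : nat, [/\ (0 < k)%N, k%:R * phi <= 2 * pi &
    Defs.arc t0 l (expi (k%:R * phi))].
Proof.
move=> /andP[p0 pl] n1.
have pi0 : 0 < 2 * pi :> R by rewrite mulr_gt0// pi_gt0.
(* [t1] is the initial angle reduced modulo [2 pi] to the first turn *)
pose f := Num.floor (t0 / (2 * pi)).
pose t1 := t0 - f%:~R * (2 * pi).
have t1I : 0 <= t1 < 2 * pi.
  have /andP[] := floor_itv (t0 / (2 * pi)).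
  rewrite -/f ler_pdivlMr// ltr_pdivrMr// intrD mulrDl mul1r /t1 => ? ?.
  by apply/andP; split; lra.
have expf t : expi (t1 + t) = expi (t0 + t) :> R[i].
  rewrite /t1; case: (f) => n.
    by rewrite -pmulrn -[RHS](expiB2pi _ n); congr expi; ring.
  by rewrite NegzE mulrNz -pmulrn -[LHS](expiB2pi _ n.+1); congr expi; ring.
have t1l : t1 + l < 2 * pi.
  rewrite ltNge; apply/negP => h; apply: n1; exists (2 * pi - t1).
    by rewrite /= in_itv /=; case/andP: t1I => ? ?; apply/andP; split; lra.
  by rewrite -expf addrC subrK -(expiB2pi _ 1) mul1r subrr expi0.
case/andP: t1I => t10 _.
have t1p : 0 <= t1 / phi by rewrite divr_ge0// ltW.
have := truncn_itv t1p; rewrite ler_pdivlMr// ltr_pdivrMr//.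
move: (Num.truncn _) => k.
have -> : k.+1%:R * phi = k%:R * phi + phi by rewrite -natr1 mulrDl mul1r.
move=> /andP[k1 k2]; exists k.+1.
have -> : k.+1%:R * phi = k%:R * phi + phi by rewrite -natr1 mulrDl mul1r.
split=> //; first lra.
exists (k%:R * phi + phi - t1).
  by rewrite /= in_itv /=; apply/andP; split; lra.
by rewrite -expf; congr expi; ring.
Qed.

(** For a negative step, complex conjugation reflects the arc and reverses the
    step. *)
Lemma return_to_arc (t0 l phi : R) : phi != 0 -> `|phi| <= l -> ~ Defs.arc t0 l 1 ->
  exists k : nat, [/\ (0 < k)%N, k%:R * `|phi| <= 2 * pi &
    Defs.arc t0 l (expi phi ^+ k)].
Proof.
move=> phi0 phil n1.
have [p0|p0] := ltP 0 phi.
  have [|k [k0 k1 k2]] := @return_to_arc_pos t0 l phi _ n1.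
    by rewrite p0 -(gtr0_norm p0).
  by exists k; rewrite expiX (gtr0_norm p0).
have {}p0 : phi < 0 by rewrite lt_neqAle phi0.
have refl t : Defs.arc (- t0 - l) l (expi t) -> Defs.arc t0 l (expi (- t)).
  move=> [s sI /expi_eqN E]; exists (l - s).
    by move: sI; rewrite /= !in_itv /= => /andP[? ?]; apply/andP; split; lra.
  by rewrite -E; congr expi; ring.
have [||k [k0 k1 k2]] := @return_to_arc_pos (- t0 - l) l `|phi|.
- by rewrite phil normr_gt0 phi0.
- by rewrite -expi0 => /refl; rewrite oppr0 expi0.
exists k; split=> //; rewrite expiX.
by have := refl _ k2; rewrite ltr0_norm// mulrN opprK.
Qed.

End Angles.

(** * Roots of unity *)

Section Orders.
Variable R : realType.
Implicit Types (xi : R[i]).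

Lemma root_of_unity_norm xi : Defs.root_of_unity xi -> rnorm xi = 1.
Proof.
move=> [n n0 xin]; apply/eqP; rewrite -(@eqrXn2 _ n) ?rnorm_ge0//.
by rewrite -rnormX xin rnorm1 expr1n.
Qed.

Lemma ord_prim xi : Defs.root_of_unity xi -> (Defs.ord xi).-primitive_root xi.
Proof.
move=> [n n0 xin]; have [d dP _] := prim_order_exists n0 xin.
by rewrite /Defs.ord; case: xgetP => [m _ //|/(_ d)].
Qed.

Lemma ord_gt0 xi : Defs.root_of_unity xi -> (0 < Defs.ord xi)%N.
Proof. by move/ord_prim/prim_order_gt0. Qed.

Lemma ord_le_max (E : set R[i]) xi : finite_set E -> E xi ->
  (Defs.ord xi <= max_ord E)%N.
Proof.
move=> Efin Exi; rewrite /max_ord.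
have xiE : xi \in fset_set E by rewrite in_fset_set// inE.
by rewrite (big_rem xi)//= leq_maxl.
Qed.

Lemma finite_roots_of_unity (n : nat) : (0 < n)%N ->
  finite_set [set z : R[i] | z ^+ n = 1].
Proof.
move=> n0; have [r rE] := closed_field_poly_normal ('X^n - 1 : {poly R[i]}).
have := finite_seq r; apply: sub_finite_set => z /= zn.
have : root ('X^n - 1) z by rewrite rootE !hornerE zn subrr.
rewrite rE lead_coefXnsubC// scale1r.
by rewrite root_prod_XsubC.
Qed.

(** Dirichlet's argument: two of the [m + 1] powers [xi^0], ..., [xi^m] fall in
    the same of [m] equal sectors, and their quotient is the required power. *)
Lemma power_near_one (m : nat) xi : (0 < m)%N -> rnorm xi = 1 ->
  exists n (t : R), [/\ (0 < n <= m)%N, xi ^+ n = expi t & `|t| <= 2 * pi / m%:R].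
Proof.
move=> m0 xi1.
have pi0 : 0 < 2 * pi :> R by rewrite mulr_gt0// pi_gt0.
have mR0 : 0 < m%:R :> R by rewrite ltr0n.
have h (j : 'I_m.+1) : {t : R | 0 <= t < 2 * pi /\ xi ^+ j = expi t}.
  apply: cid; have [|t t1 t2] := @circle_expi_2pi R (xi ^+ j).
    by rewrite rnormX xi1 expr1n.
  by exists t.
pose th j := sval (h j).
have th0 j : 0 <= th j * m%:R / (2 * pi).
  apply: divr_ge0; last exact: ltW.
  by rewrite mulr_ge0//; case: (svalP (h j)) => /andP[].
have cellP j : (Num.truncn (th j * m%:R / (2 * pi)) < m)%N.
  rewrite truncn_lt_nat// ltr_pdivrMr// [ltRHS]mulrC ltr_pM2r//.
  by case: (svalP (h j)) => /andP[].
pose cell j : 'I_m := Ordinal (cellP j).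
have [i [j [ij cij]]] : exists i j : 'I_m.+1, (i < j)%N /\ cell i = cell j.
  have : ~~ injectiveb cell.
    apply/negP => /injectiveP /leq_card; rewrite !card_ord ltnn//.
  move=> /injectivePn[i [j ij E]].
  case: (ltngtP i j) ij => [ij _|ij _|/val_inj ->]; last by rewrite eqxx.
    by exists i, j.
  by exists j, i.
exists (j - i)%N, (th j - th i); split.
- by rewrite subn_gt0 ij /= (leq_trans (leq_subr _ _))// -ltnS.
- have xi0 : xi != 0 by rewrite -rnorm_gt0 xi1.
  apply: (mulfI (expf_neq0 i xi0)); rewrite -exprD subnKC ?(ltnW ij)//.
  case: (svalP (h i)) => _ ->; case: (svalP (h j)) => _ ->.
  by rewrite -expiD addrC subrK.
- have /andP[a1 a2] := truncn_itv (th0 i).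
  have /andP[b1 b2] := truncn_itv (th0 j).
  have E : Num.truncn (th i * m%:R / (2 * pi)) =
           Num.truncn (th j * m%:R / (2 * pi)) by case: cij.
  rewrite E in a1 a2; move: (Num.truncn _) a1 a2 b1 b2 => k a1 a2 b1 b2.
  move: a1 a2 b1 b2.
  rewrite -[k.+1%:R]natr1 !ler_pdivlMr// !ltr_pdivrMr// => a1 a2 b1 b2.
  rewrite -[X in _ * X](gtr0_norm mR0) -normrM mulrBl.
  rewrite ler_norml; apply/andP; split; lra.
Qed.

End Orders.

(** * The function w and its powers *)

Section Scalars.
Variables (R : realType) (c : nat -> R[i]).
Hypothesis c_A11 : A11 c.
Implicit Types (z xi eta : R[i]) (q Q : R).

Lemma cvg_norm_coeffs : cvgn (series (fun k => rnorm (c k))).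
Proof.
apply: series_le_cvg c_A11 => k; rewrite ?mulr_ge0 ?rnorm_ge0//.
by rewrite ler_peMl ?rnorm_ge0// ler1n.
Qed.

Lemma is_cvg_eval z : rnorm z <= 1 ->
  cvgn (fun n => \sum_(k < n) c k * z ^+ k : R[i]^o).
Proof.
move=> z1; apply: (@abs_series_cvg R R[i]^o (fun k => c k * z ^+ k)
   (fun k => rnorm (c k)) (@complex_complete R) _ cvg_norm_coeffs) => k.
rewrite (rnormM (c k) (z ^+ k)) rnormX ler_piMr ?rnorm_ge0//.
by rewrite exprn_ile1 ?rnorm_ge0.
Qed.

Lemma cvg_eval z : rnorm z <= 1 ->
  (fun n => \sum_(k < n) c k * z ^+ k : R[i]^o) @ \oo --> (Defs.eval c z : R[i]^o).
Proof. exact: is_cvg_eval. Qed.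

Lemma eval_bounded : exists B, forall z, rnorm z <= 1 -> rnorm (Defs.eval c z) <= B.
Proof.
exists (limn (series (fun k => rnorm (c k)))) => z z1.
apply: (rnorm_lim_le (cvg_eval z1)) => n.
apply: le_trans (@rnorm_sum _ R[i]^o _ _ _ _) _.
apply: (@le_trans _ _ (series (fun k => rnorm (c k)) n)).
  rewrite /series /= big_mkord; apply: ler_sum => k _.
  rewrite (rnormM (c k) (z ^+ k)) rnormX ler_piMr ?rnorm_ge0//.
  by rewrite exprn_ile1 ?rnorm_ge0.
apply: nondecreasing_cvgn_le; last exact: cvg_norm_coeffs.
by apply: nondecreasing_series => k _ _; exact: rnorm_ge0.
Qed.

(** The sums start at 0, where the term vanishes, to match the partial sums of
    [w]. *)
Lemma sum_le_Lw (n : nat) : \sum_(k < n) k%:R * rnorm (c k) <= Lw c.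
Proof.
have E : (fun n => \sum_(1 <= k < n) k%:R * rnorm (c k) : R) =
         series (fun k => k%:R * rnorm (c k)).
  apply/funext => -[|m]; rewrite /series /=; first by rewrite !big_geq.
  by rewrite [RHS]big_nat_recl//= mul0r add0r big_add1.
rewrite /Lw E; have -> : \sum_(k < n) k%:R * rnorm (c k) =
  series (fun k => k%:R * rnorm (c k)) n by rewrite /series /= big_mkord.
apply: nondecreasing_cvgn_le.
  by apply: nondecreasing_series => k _ _; rewrite mulr_ge0 ?rnorm_ge0.
apply: series_le_cvg c_A11 => k; rewrite ?mulr_ge0 ?rnorm_ge0//.
by rewrite ler_wpM2r ?rnorm_ge0// ler_nat.
Qed.

Lemma Lw_ge0 : 0 <= Lw c.
Proof. by have := sum_le_Lw 0; rewrite big_ord0. Qed.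

Lemma EsetP q z : Eset c q z <->
  rnorm z = 1 /\ forall n, (1 <= n)%N -> rnorm (Defs.eval c (z ^+ n)) <= q.
Proof.
have [B hB] := eval_bounded.
have zn n : rnorm z = 1 -> rnorm (z ^+ n) <= 1 by move=> z1; rewrite rnormX z1 expr1n.
split=> -[z1 h]; split=> //.
  move=> n n1; apply: le_trans h; apply: ub_le_sup; last by exists n.
  by exists B => _ [m _ <-]; apply: hB; exact: zn.
apply: ge_sup; first by exists (rnorm (Defs.eval c (z ^+ 1))); exists 1%N.
by move=> _ [n n1 <-]; exact: h.
Qed.

Lemma le_maxpow (N n : nat) z : (1 <= n <= N)%N ->
  rnorm (Defs.eval c (z ^+ n)) <= maxpow c N z.
Proof.
move=> nN.
apply: (le_bigmax_seq 0 n xpredT (fun m => rnorm (Defs.eval c (z ^+ m)))) => //.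
by rewrite mem_index_iota ltnS.
Qed.

(** The maximum starts from the default value 0, hence [0 < q]. *)
Lemma maxpow_attained (N : nat) z q : 0 < q -> q <= maxpow c N z ->
  exists2 n, (1 <= n <= N)%N & q <= rnorm (Defs.eval c (z ^+ n)).
Proof.
move=> q0 qm; apply: contrapT => h.
have : maxpow c N z < q.
  rewrite /maxpow big_seq_cond; apply: bigmax_lt => // n.
  rewrite mem_index_iota ltnS andbT => nN; rewrite ltNge; apply/negP => qn.
  by apply: h; exists n.
by rewrite ltNge qm.
Qed.

(** By periodicity; the exponents divisible by the order are represented by the
    order itself, since the maximum starts at exponent 1. *)
Lemma le_bw xi n : Defs.root_of_unity xi -> (1 <= n)%N ->
  rnorm (Defs.eval c (xi ^+ n)) <= bw c xi.
Proof.
move=> xiU n1; have xiP := ord_prim xiU; have o0 := ord_gt0 xiU.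
rewrite -(prim_expr_mod xiP).
case E: (n %% Defs.ord xi)%N => [|m]; last first.
  by apply: le_maxpow; rewrite /= -E ltnW// ltn_mod.
by rewrite expr0 -(prim_expr_order xiP); apply: le_maxpow; rewrite o0 leqnn.
Qed.

Lemma Eset_le q Q : q <= Q -> Eset c q `<=` Eset c Q.
Proof.
move=> qQ z /EsetP[z1 h]; apply/EsetP; split=> // n n1.
exact: le_trans (h n n1) qQ.
Qed.

(** * Separation of powers from the set E *)

Section Threshold.
Variables (Q t0 l a : R) (N : nat).
Hypothesis Q_threshold : peripheral_threshold c Q.
Hypothesis data : admissible c Q t0 l a N.

Lemma Q_gt0 : 0 < Q. Proof. by case: Q_threshold => /andP[]. Qed.

Lemma threshold_in_Eset : exists2 xi, Eset c Q xi & Defs.root_of_unity xi.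
Proof.
have [_ [xi xiU xiQ]] := Q_threshold; exists xi => //; apply/EsetP; split.
  exact: root_of_unity_norm.
by move=> n n1; rewrite -xiQ; exact: le_bw.
Qed.

(** The power of order [ord xi] of a point [xi] of [E_+] is 1, so that
    [|w(1)| <= Q]. *)
Lemma one_notin_arc : ~ Defs.arc t0 l 1.
Proof.
case: data => _ Qa harc _ /harc.
have [xi /EsetP[_ xiQ] xiU] := threshold_in_Eset.
have := xiQ _ (ord_gt0 xiU); rewrite (prim_expr_order (ord_prim xiU)); lra.
Qed.

Lemma arc_ge z : Defs.arc t0 l z -> a <= rnorm (Defs.eval c z).
Proof. by case: data => _ _ h _; exact: h. Qed.

(** Some power with exponent at most [m] is within [l] of 1.  Were it not 1
    itself, its multiples would reach the arc, where [|w| > Q]. *)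
Lemma Eset_period : exists2 m : nat, (0 < m)%N &
  forall xi, Eset c Q xi -> exists2 n, (0 < n <= m)%N & xi ^+ n = 1.
Proof.
case: (data) => /andP[l0 _] Qa _ _.
have pi0 : 0 < 2 * pi :> R by rewrite mulr_gt0// pi_gt0.
exists (Num.truncn (2 * pi / l)).+1 => // xi /EsetP[xi1 xiQ].
have [//|n [t [nm xin tm]]] := @power_near_one R (Num.truncn (2 * pi / l)).+1 xi _ xi1.
exists n => //; rewrite xin.
have [->|tn0] := eqVneq t 0; first exact: expi0.
have tl : `|t| <= l.
  apply: le_trans tm _; rewrite ler_pdivrMr// [leRHS]mulrC -ler_pdivrMr//.
  have h0 : 0 <= 2 * pi / l by rewrite divr_ge0// ltW.
  by have /andP[_ /ltW] := truncn_itv h0.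
have [k [k0 _ /arc_ge]] := return_to_arc tn0 tl one_notin_arc.
rewrite -xin -exprM; case/andP: nm => n0 _.
have := xiQ (n * k)%N; rewrite muln_gt0 n0 k0 => /(_ isT) ? ?; exfalso; lra.
Qed.

Lemma Eset_root xi : Eset c Q xi -> Defs.root_of_unity xi.
Proof.
have [m _ h] := Eset_period => /h[n /andP[n0 _] xin]; by exists n.
Qed.

Lemma Eset_finite : finite_set (Eset c Q).
Proof.
have [m m0 h] := Eset_period.
have := finite_roots_of_unity R (fact_gt0 m); apply: sub_finite_set => xi /h.
move=> [n nm xin] /=; have /dvdnP[k ->] : (n %| m`!)%N by exact: dvdn_fact.
by rewrite mulnC exprM xin expr1n.
Qed.

Lemma max_ord_gt0 : (0 < max_ord (Eset c Q))%N.
Proof.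
have [xi xiE xiU] := threshold_in_Eset.
exact: leq_trans (ord_gt0 xiU) (ord_le_max Eset_finite xiE).
Qed.

(** The maximum in the definition of [C_+]: a bound for
    [n |eta - xi| / (|w(eta^n)| - Q)]. *)
Definition gap_const : R :=
  if `[< F0 c Q l = set0 >] then 2 * pi / (a - Q)
  else Num.max (2 * pi / (a - Q)) (2 * N%:R / gap c Q l N).

Lemma gap_const_ge : 2 * pi / (a - Q) <= gap_const.
Proof. by rewrite /gap_const; case: ifP => // _; rewrite le_max lexx. Qed.

Lemma gap_const_gt0 : 0 < gap_const.
Proof.
apply: lt_le_trans gap_const_ge; case: (data) => _ Qa _ _.
by rewrite divr_gt0 ?subr_gt0// mulr_gt0// pi_gt0.
Qed.

(** Close to [xi] of order [d], the powers of [eta] with exponents divisible by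
    [d] do not see [xi] and rotate by [d] times the angle from [xi] to [eta],
    which is less than [l / 2]; they return to the arc.  Elsewhere, the gap
    condition applies and [|eta - xi| <= 2] for any [xi]. *)
Lemma power_separation eta : rnorm eta = 1 ->
  exists2 xi, Eset c Q xi & eta = xi \/
    exists n, [/\ (1 <= n)%N, Q < rnorm (Defs.eval c (eta ^+ n)) &
      n%:R * rnorm (eta - xi) <= gap_const * (rnorm (Defs.eval c (eta ^+ n)) - Q)].
Proof.
move=> eta1; case: (data) => /andP[l0 _] Qa _ hgap.
have D0 : 0 < (max_ord (Eset c Q))%:R :> R by rewrite ltr0n max_ord_gt0.
have [etaU|etaU] := pselect (Uset c Q l eta).
  case: etaU => _ [xi xiE angle]; exists xi => //.
  have xiU := Eset_root xiE; have xi1 := root_of_unity_norm xiU.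
  have xi0 : xi != 0 by rewrite -rnorm_gt0 xi1.
  have [|t tE etaE] := @circle_expi R (eta / xi).
    by rewrite rnormM rnormV eta1 xi1 invr1 mulr1.
  have {}etaE : eta = xi * expi t by rewrite -etaE mulrC divfK.
  move: angle; rewrite /angdist -tE => angle.
  have [t00|tn0] := eqVneq t 0; first by left; rewrite etaE t00 expi0 mulr1.
  right; pose d := Defs.ord xi.
  have d0 : 0 < d%:R :> R by rewrite ltr0n ord_gt0.
  have dt : `|d%:R * t| <= l.
    rewrite normrM (gtr0_norm d0).
    (* this is where the radius [l / (2 D)] of the neighbourhoods enters *)
    have dD : d%:R <= (max_ord (Eset c Q))%:R :> R.
      by rewrite ler_nat ord_le_max//; exact: Eset_finite.
    have : `|t| * (2 * (max_ord (Eset c Q))%:R) < l by rewrite -ltr_pdivlMr// mulr_gt0.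
    have := ler_wpM2r (normr_ge0 t) dD; have := normr_ge0 t; nra.
  have dt0 : d%:R * t != 0 by rewrite mulf_neq0// gt_eqF.
  have [k [k0 kpi /arc_ge ka]] := return_to_arc dt0 dt one_notin_arc.
  have E : eta ^+ (d * k) = expi (d%:R * t) ^+ k.
    rewrite exprM etaE exprMn (prim_expr_order (ord_prim xiU)) mul1r.
    by rewrite [expi t ^+ _]expiX.
  exists (d * k)%N; rewrite E; split.
  - by rewrite muln_gt0 k0 ord_gt0.
  - lra.
  - apply: (@le_trans _ _ (2 * pi)).
      apply: le_trans kpi; rewrite natrM normrM (gtr0_norm d0) mulrCA mulrA.
      by rewrite ler_wpM2l ?mulr_ge0// etaE rnorm_rotation.
    apply: (@le_trans _ _ (gap_const * (a - Q))).
      by rewrite -ler_pdivrMr ?subr_gt0// gap_const_ge.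
    by rewrite ler_pM2l ?gap_const_gt0// lerD2r.
have etaF : F0 c Q l eta by split.
have F0n : F0 c Q l !=set0 by exists eta.
have [N1 g0] := hgap F0n.
have [xi xiE xiU] := threshold_in_Eset; exists xi => //; right.
have [||n nN hn] := @maxpow_attained N eta (Q + gap c Q l N).
- by rewrite addr_gt0// Q_gt0.
- rewrite /gap addrC subrK; apply: ge_inf; last by exists eta.
  by exists 0 => _ [z _ <-]; rewrite /maxpow; exact: bigmax_ge_id.
case/andP: nN => n1 nN; exists n; split=> //; first lra.
have dist2 : rnorm (eta - xi) <= 2.
  apply: le_trans (rnormD _ _) _.
  by rewrite rnormN eta1 (root_of_unity_norm xiU).
apply: (@le_trans _ _ (gap_const * gap c Q l N)); last first.
  rewrite ler_pM2l ?gap_const_gt0//; lra.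
apply: (@le_trans _ _ (2 * N%:R)).
  by rewrite mulrC ler_pM ?rnorm_ge0// ler_nat.
rewrite -ler_pdivrMr// /gap_const asboolF; last by case: F0n => z; move=> + E; rewrite E.
by rewrite le_max lexx orbT.
Qed.

End Threshold.
End Scalars.

(** * Operators and power bounds *)

Section OperatorBounds.
Variables (R : realType) (X : completeNormedModType R[i]).
Implicit Types (x y : X) (lambda : R[i]) (b : R).

Lemma opnorm_bound (S : X -> X) b : (forall (r : R[i]) x, S (r *: x) = r *: S x) ->
  (opnorm S <= b%:E)%E -> forall x, rnorm (S x) <= b * rnorm x.
Proof.
move=> SZ Sb x; have [->|x0] := eqVneq x 0.
  by rewrite -(scale0r (0 : X)) SZ !scale0r rnorm0 mulr0.
have nx0 : 0 < rnorm x by rewrite rnorm_gt0.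
pose r : R[i] := ((rnorm x)^-1)%:C.
have nr : rnorm r = (rnorm x)^-1 by rewrite rnormC ger0_norm// invr_ge0 ltW.
rewrite -ler_pdivrMr// mulrC -nr -rnormZ -SZ -lee_fin.
apply: le_trans Sb; apply: ereal_sup_ubound; exists (r *: x) => //=.
by rewrite rnormZ nr mulVf ?gt_eqF.
Qed.

Lemma le_opnorm (S : X -> X) b : (forall x, rnorm x <= 1 -> rnorm (S x) <= b) ->
  (opnorm S <= b%:E)%E.
Proof. by move=> h; apply: ge_ereal_sup => _ [x x1 <-]; rewrite lee_fin h. Qed.

Lemma bounded_continuous (S : {linear X -> X}) b :
  (forall x, rnorm (S x) <= b * rnorm x) -> continuous S.
Proof.
move=> Sb x; apply/cvg_rnormP => e e0.
have b0 : 0 < `|b| + 1 by rewrite ltr_wpDl.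
have eb0 : 0 < e / (`|b| + 1) by rewrite divr_gt0.
have /cvg_rnormP/(_ _ eb0) : (y : X) @[y --> x] --> x by exact: cvg_id.
apply: filterS => y; rewrite ltr_pdivlMr// => xy.
rewrite -linearB; apply: le_lt_trans xy; apply: le_trans (Sb _) _.
rewrite mulrC ler_wpM2l ?rnorm_ge0//.
by apply: le_trans (ler_norm b) _; rewrite lerDl.
Qed.

Section Iterates.
Variable T : {linear X -> X}.

Lemma iterZ n (r : R[i]) x : iter n T (r *: x) = r *: iter n T x.
Proof. by elim: n => //= n ->; rewrite linearZ. Qed.

Lemma iterB n x y : iter n T (x - y) = iter n T x - iter n T y.
Proof. by elim: n => //= n ->; rewrite linearB. Qed.

Lemma iterD n x y : iter n T (x + y) = iter n T x + iter n T y.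
Proof. by elim: n => //= n ->; rewrite linearD. Qed.

End Iterates.

Section PowerBound.
Variables (T : {linear X -> X}) (M0 : R).
Hypothesis M0_ge1 : 1 <= M0.
Hypothesis T_bound : forall n x, rnorm (iter n T x) <= M0 * rnorm x.

Lemma iter_defect_step lambda m x :
  rnorm (lambda ^+ m.+1 *: x - iter m.+1 T x) <=
  rnorm lambda * rnorm (lambda ^+ m *: x - iter m T x) +
  M0 * rnorm (lambda *: x - T x).
Proof.
have -> : lambda ^+ m.+1 *: x - iter m.+1 T x =
    lambda *: (lambda ^+ m *: x - iter m T x) + iter m T (lambda *: x - T x).
  by rewrite iterB iterZ scalerBr scalerA -exprS -iterSr addrA subrK.
by apply: le_trans (rnormD _ _) _; rewrite rnormZ lerD2l.
Qed.

Lemma iter_defect_circle lambda m x : rnorm lambda = 1 ->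
  rnorm (lambda ^+ m *: x - iter m T x) <= m%:R * (M0 * rnorm (lambda *: x - T x)).
Proof.
move=> l1; elim: m => [|m IH].
  by rewrite expr0 scale1r subrr rnorm0 mul0r.
apply: le_trans (iter_defect_step _ _ _) _.
by rewrite l1 mul1r -natr1 mulrDl mul1r lerD2r.
Qed.

(** The classical [|(lambda - T)^-1| <= M0 / (|lambda| - 1)], as a lower bound.
    With [r = |lambda|], summing the steps gives
    [(r - 1) |lambda^m x - T^m x| <= r^m M0 |lambda x - T x|], while
    [|lambda^m x - T^m x| >= (r^m - M0) |x|]; divide by [r^m] and let [m] grow. *)
Lemma outside_lower_bound lambda x : 1 <= rnorm lambda ->
  (rnorm lambda - 1) * rnorm x <= M0 * rnorm (lambda *: x - T x).
Proof.
rewrite le_eqVlt => /orP[/eqP <-|r1].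
  rewrite subrr mul0r mulr_ge0 ?rnorm_ge0 ?(le_trans ler01 M0_ge1)//.
set r := rnorm lambda in r1 *; set y := M0 * rnorm (lambda *: x - T x).
have y0 : 0 <= y by rewrite mulr_ge0 ?rnorm_ge0 ?(le_trans ler01 M0_ge1)//.
(* a weak form of Bernoulli's inequality *)
have growth m : m%:R * (r - 1) <= r ^+ m.
  elim: m => [|m IH]; first by rewrite mul0r expr0.
  have rm : 1 <= r ^+ m by rewrite exprn_ege1// ltW.
  rewrite (exprS r) -natr1; nra.
have defect m : (r - 1) * rnorm (lambda ^+ m *: x - iter m T x) <= r ^+ m * y.
  (* the sharper factor [r^m - 1] makes the induction work *)
  suff : (r - 1) * rnorm (lambda ^+ m *: x - iter m T x) <= (r ^+ m - 1) * y by lra.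
  elim: m => [|m IH]; first by rewrite !expr0 scale1r !subrr rnorm0 mulr0 mul0r.
  have := iter_defect_step lambda m x; rewrite -/r -/y => st.
  have r10 : 0 <= r - 1 by rewrite subr_ge0 ltW.
  have r0 : 0 <= r by lra.
  have := ler_wpM2l r10 st; have := ler_wpM2l r0 IH; rewrite (exprS r); lra.
rewrite leNgt; apply/negP => yx.
pose d := (r - 1) * rnorm x - y; have d0 : 0 < d by rewrite subr_gt0.
have dm m : r ^+ m * d <= (r - 1) * (M0 * rnorm x).
  have := rnorm_leB (lambda ^+ m *: x) (iter m T x).
  rewrite rnormZ rnormX -/r => h.
  have r10 : 0 <= r - 1 by rewrite subr_ge0 ltW.
  have := ler_wpM2l r10 h; have := ler_wpM2l r10 (T_bound m x).
  have := defect m; rewrite /d; lra.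
pose B := (r - 1) * (M0 * rnorm x).
have B0 : 0 <= B.
  rewrite !mulr_ge0 ?rnorm_ge0 ?(le_trans ler01 M0_ge1) ?subr_ge0 ?(ltW r1)//.
have rd0 : 0 < (r - 1) * d by rewrite mulr_gt0// subr_gt0.
have Bd0 : 0 <= B / ((r - 1) * d) by rewrite divr_ge0// ltW.
have /andP[_] := truncn_itv Bd0; move: (Num.truncn _) => k.
rewrite ltr_pdivrMr// mulrA => Bk.
have := lt_le_trans Bk (le_trans (ler_wpM2r (ltW d0) (growth k.+1)) (dm k.+1)).
by rewrite ltxx.
Qed.

End PowerBound.

(** * Lower bounds from the functional calculus *)

Section Calculus.
Variables (c : nat -> R[i]) (T : {linear X -> X}) (M0 : R).
Hypothesis c_A11 : A11 c.
Hypothesis M0_ge1 : 1 <= M0.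
Hypothesis T_bound : forall n x, rnorm (iter n T x) <= M0 * rnorm x.

Lemma cvg_opeval n x :
  (fun m => \sum_(k < m) c k *: iter k (iter n T) x) @ \oo
    --> opeval c (iter n T) x.
Proof.
apply: (@abs_series_cvg R X (fun k => c k *: iter k (iter n T) x)
  (fun k => M0 * rnorm x * rnorm (c k)) (fun F => @cauchy_cvg X F)).
  by move=> k; rewrite rnormZ mulrC -iterM ler_wpM2r ?rnorm_ge0.
rewrite (_ : series _ = fun m => M0 * rnorm x * series (fun k => rnorm (c k)) m).
  by apply: is_cvgMr; exact: cvg_norm_coeffs.
by apply/funext => m; rewrite /series /= mulr_sumr.
Qed.

Lemma opevalZ n (r : R[i]) x :
  opeval c (iter n T) (r *: x) = r *: opeval c (iter n T) x.
Proof.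
apply/cvg_lim => //.
have -> : (fun m => \sum_(k < m) c k *: iter k (iter n T) (r *: x)) =
    r \*: (fun m => \sum_(k < m) c k *: iter k (iter n T) x).
  apply/funext => m /=; rewrite scaler_sumr; apply: eq_bigr => k _.
  by rewrite -!iterM iterZ !scalerA mulrC.
exact: cvgZl_tmp (@cvg_opeval n x).
Qed.

(** Termwise telescoping in [w(lambda^n) x - w(T^n) x]; the weight [k] of
    [|c_k|] counts the telescoping steps and produces [L_w]. *)
Lemma calculus_lower_bound n q lambda x : rnorm lambda = 1 ->
  (forall x, rnorm (opeval c (iter n T) x) <= q * rnorm x) ->
  (rnorm (Defs.eval c (lambda ^+ n)) - q) * rnorm x <=
  n%:R * (M0 * Lw c) * rnorm (lambda *: x - T x).
Proof.
move=> l1 hq; set y := lambda *: x - T x.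
have ln1 : rnorm (lambda ^+ n) <= 1 by rewrite rnormX l1 expr1n.
suff h : rnorm (Defs.eval c (lambda ^+ n) *: x - opeval c (iter n T) x) <=
    n%:R * (M0 * Lw c) * rnorm y.
  have := rnorm_leB (Defs.eval c (lambda ^+ n) *: x) (opeval c (iter n T) x).
  by have := hq x; rewrite rnormZ; lra.
apply: (rnorm_lim_le (cvgB (cvgZr_tmp (a := x) (cvg_eval c_A11 ln1))
  (@cvg_opeval n x))) => m.
rewrite !fctE scaler_suml -sumrB.
apply: le_trans (rnorm_sum _ _ _) _.
have y0 : 0 <= n%:R * M0 * rnorm y.
  by rewrite !mulr_ge0 ?rnorm_ge0 ?(le_trans ler01 M0_ge1)//.
have := ler_wpM2l y0 (sum_le_Lw c_A11 m); rewrite mulr_sumr => h.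
rewrite mulrA [leRHS]mulrAC; apply: le_trans h; apply: ler_sum => k _.
have -> : c k * (lambda ^+ n) ^+ k *: x - c k *: iter k (iter n T) x =
    c k *: (lambda ^+ (k * n) *: x - iter (k * n) T x).
  by rewrite scalerBr scalerA -iterM mulnC -exprM.
rewrite rnormZ; have := iter_defect_circle T_bound (k * n) x l1.
move/(ler_wpM2l (rnorm_ge0 (c k))); rewrite natrM -/y => h.
by apply: le_trans h _; rewrite le_eqVlt; apply/orP; left; apply/eqP; ring.
Qed.

Section Level.
Variables (Q t0 l a q : R) (N : nat).
Hypothesis Q_threshold : peripheral_threshold c Q.
Hypothesis data : admissible c Q t0 l a N.
Hypothesis q_lt : q < Q.
Hypothesis wT_bound : forall n x, (1 <= n)%N ->
  rnorm (opeval c (iter n T) x) <= q * rnorm x.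

(** [calculus_lower_bound] at the exponent [n] of [power_separation], where
    [|w(eta^n)| - q] is at least the factor [|w(eta^n)| - Q] to be cancelled. *)
Lemma circle_lower_bound eta : rnorm eta = 1 -> exists2 xi, Eset c Q xi &
  forall x, rnorm (eta - xi) * rnorm x <=
    M0 * Lw c * gap_const c Q l a N * rnorm (eta *: x - T x).
Proof.
move=> eta1; have L0 := Lw_ge0 c_A11.
have G0 := gap_const_gt0 data.
have [xi xiE [->|[n [n1 Qn hn]]]] := power_separation c_A11 Q_threshold data eta1;
    exists xi => // x.
  by rewrite subrr rnorm0 mul0r !mulr_ge0 ?rnorm_ge0 ?(ltW G0)
    ?(le_trans ler01 M0_ge1)//.
have h := @calculus_lower_bound n q eta x eta1 (fun x => wT_bound x n1).
set v := rnorm (Defs.eval c (eta ^+ n)) in Qn hn h.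
set y := rnorm (eta *: x - T x) in h *.
have vQ : 0 < v - Q by rewrite subr_gt0.
have x0 := rnorm_ge0 x; have y0 : 0 <= y := rnorm_ge0 _.
rewrite -(ler_pM2l vQ).
have d0 := rnorm_ge0 (eta - xi).
apply: (@le_trans _ _ (rnorm (eta - xi) * ((v - q) * rnorm x))).
  by rewrite mulrCA ler_wpM2l// ler_wpM2r// lerD2l lerN2 ltW.
apply: le_trans (ler_wpM2l d0 h) _.
have MLy : 0 <= M0 * Lw c * y by rewrite !mulr_ge0 ?(le_trans ler01 M0_ge1)//.
have := ler_wpM2r MLy hn.
by congr (_ <= _); ring.
Qed.

(** Compare [lambda] with [eta = lambda / |lambda|].  Passing from [eta] to
    [lambda] changes the distance to [xi] by [|lambda| - 1] and the image of [x]
    by [(|lambda| - 1) |x|]; by [outside_lower_bound] these cost the summand [M0]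
    and the factor [1 + M0] of [C_+]. *)
Lemma exterior_lower_bound lambda : 1 <= rnorm lambda ->
  exists2 xi, Eset c Q xi &
  forall x, rnorm (lambda - xi) * rnorm x <=
    Cplus c Q M0 l a N * rnorm (lambda *: x - T x).
Proof.
move=> r1; have r0 : 0 < rnorm lambda by lra.
pose eta := lambda / (rnorm lambda)%:C.
have nr : rnorm ((rnorm lambda)%:C : R[i]) = rnorm lambda.
  by rewrite rnormC ger0_norm// ltW.
have rC0 : (rnorm lambda)%:C != 0 :> R[i] by rewrite -rnorm_gt0 nr.
have eta1 : rnorm eta = 1 by rewrite rnormM rnormV nr mulfV// gt_eqF.
have lE : lambda = eta * (rnorm lambda)%:C by rewrite divfK.
have le : rnorm (lambda - eta) = rnorm lambda - 1.
  rewrite {1}lE -[X in _ - X]mulr1 -mulrBr rnormM eta1 mul1r.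
  have -> : (rnorm lambda)%:C - 1 = (rnorm lambda - 1)%:C :> R[i].
    by rewrite rmorphB rmorph1.
  by rewrite rnormC ger0_norm// subr_ge0.
have [xi xiE h] := circle_lower_bound eta1; exists xi => // x.
have out := outside_lower_bound M0_ge1 T_bound x r1.
set y := rnorm (lambda *: x - T x) in out *.
have dE : rnorm (lambda - xi) <= rnorm lambda - 1 + rnorm (eta - xi).
  by rewrite -le; have := rnormD (lambda - eta) (eta - xi); rewrite subrKA.
have yE : rnorm (eta *: x - T x) <= y + (rnorm lambda - 1) * rnorm x.
  have -> : eta *: x - T x = (lambda *: x - T x) + (eta - lambda) *: x.
    by rewrite scalerBl [RHS]addrC addrA subrK.
  by rewrite -le [rnorm (lambda - eta)]rnormB -rnormZ rnormD.
have CE : Cplus c Q M0 l a N = M0 + (1 + M0) * (M0 * Lw c * gap_const c Q l a N).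
  by rewrite /Cplus /gap_const; ring.
rewrite CE; set B := M0 * Lw c * _ in h *.
have B0 : 0 <= B.
  rewrite !mulr_ge0 ?(Lw_ge0 c_A11) ?(ltW (gap_const_gt0 data))
    ?(le_trans ler01 M0_ge1)//.
have := ler_wpM2l B0 yE; have := ler_wpM2l B0 out; have := h x.
have := ler_wpM2r (rnorm_ge0 x) dE; lra.
Qed.

(** Outside [E_-] the value [Q] is attained by [|w|] at one of the first
    [ord xi] powers of [xi]. *)
Lemma threshold_point_lower_bound xi x : Eset c Q xi -> ~ Eminus c Q xi ->
  (Q - q) * rnorm x <=
  M0 * Lw c * (max_ord (Eset c Q))%:R * rnorm (xi *: x - T x).
Proof.
move=> xiE xiN; have xiU := Eset_root c_A11 Q_threshold data xiE.
have Qb : Q <= bw c xi by rewrite leNgt; apply/negP => h; apply: xiN; split.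
have [n /andP[n1 nd] Qn] := maxpow_attained (Q_gt0 Q_threshold) Qb.
have h := @calculus_lower_bound n q xi x (root_of_unity_norm xiU)
  (fun x => wT_bound x n1).
have L0 : 0 <= M0 * Lw c by rewrite mulr_ge0 ?(Lw_ge0 c_A11) ?(le_trans ler01 M0_ge1)//.
apply: (@le_trans _ _ (n%:R * (M0 * Lw c) * rnorm (xi *: x - T x))).
  by apply: le_trans h; rewrite ler_wpM2r ?rnorm_ge0// lerD2r.
rewrite ler_wpM2r ?rnorm_ge0// mulrC ler_wpM2l// ler_nat.
exact: leq_trans nd (ord_le_max (Eset_finite c_A11 Q_threshold data) xiE).
Qed.

End Level.
End Calculus.
End OperatorBounds.

(** * Neumann series and the resolvent set *)

Section Resolvent.
Variables (R : realType) (X : completeNormedModType R[i]).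
Implicit Types (x y : X) (lambda mu : R[i]) (b r kappa : R).

(** The bound is on the powers of [V], not on [V] itself: this covers
    [lambda^-1 T] with [|lambda| > 1] and [T] power bounded, where the norm of
    [V] may exceed 1. *)
Lemma neumann_series (V : {linear X -> X}) b r : 0 <= r < 1 ->
  (forall k x, rnorm (iter k V x) <= b * r ^+ k * rnorm x) ->
  exists W : {linear X -> X}, [/\ continuous W,
    forall x, W (x - V x) = x & forall x, W x - V (W x) = x].
Proof.
move=> /andP[r0 r1] Vb.
have geo : cvgn (series (geometric 1 r)).
  by apply: is_cvg_geometric_series; rewrite ger0_norm.
pose s x n := \sum_(k < n) iter k V x.
pose w x := limn (s x).
have sw x : s x @ \oo --> w x.
  apply: (@abs_series_cvg R X (fun k => iter k V x)
    (fun k => b * rnorm x * geometric 1 r k) (fun F => @cauchy_cvg X F)).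
    by move=> k; rewrite /geometric /= mul1r mulrAC.
  rewrite (_ : series _ = fun m => b * rnorm x * series (geometric 1 r) m).
    exact: is_cvgMr.
  by apply/funext => m; rewrite /series /= mulr_sumr.
have w_eq x u : s x @ \oo --> u -> w x = u by move=> h; apply/cvg_lim.
have wlin : linear w.
  move=> p x y; apply: w_eq.
  rewrite (_ : s _ = (p \*: s x) + s y).
    exact: cvgD (cvgZl_tmp (sw x)) (sw y).
  apply/funext => n; transitivity (p *: s x n + s y n) => //.
  rewrite /s scaler_sumr -big_split /=.
  by apply: eq_bigr => k _; rewrite iterD iterZ.
pose W : {linear X -> X} := HB.pack w (GRing.isLinear.Build _ _ _ _ w wlin).
have wb x : rnorm (w x) <= b * limn (series (geometric 1 r)) * rnorm x.
  apply: (rnorm_lim_le (sw x)) => n; apply: le_trans (rnorm_sum _ _ _) _.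
  have b0x : 0 <= b * rnorm x.
    by have := Vb 0%N x; rewrite expr0 mulr1; apply: le_trans; exact: rnorm_ge0.
  apply: (@le_trans _ _ (b * rnorm x * series (geometric 1 r) n)).
    rewrite /series /= big_mkord mulr_sumr; apply: ler_sum => k _.
    by rewrite /geometric /= mul1r mulrAC.
  rewrite [leRHS]mulrAC ler_wpM2l//; apply: nondecreasing_cvgn_le => //.
  apply: nondecreasing_series => k _ _.
  by rewrite /geometric /= mul1r exprn_ge0.
have Vk0 x : iter n V x @[n --> \oo] --> (0 : X).
  apply/cvg_rnormP => e e0.
  have : (b * rnorm x * geometric 1 r n) @[n --> \oo] --> b * rnorm x * 0.
    by apply: cvgMr; apply: cvg_geometric; rewrite ger0_norm.
  rewrite mulr0 => /cvgrPdist_lt/(_ _ e0); apply: filterS => n.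
  rewrite !sub0r normrN rnormN => h; apply: le_lt_trans (Vb n x) _.
  by apply: le_lt_trans h; rewrite /geometric /= mul1r mulrAC ler_norm.
have Wl x : w (x - V x) = x.
  apply: w_eq; rewrite (_ : s _ = fun n => x - iter n V x).
    by rewrite -[X in _ --> X]subr0; apply: cvgB (Vk0 x); exact: cvg_cst.
  apply/funext => n; rewrite /s; elim: n => [|n IH].
    by rewrite big_ord0 subrr.
  by rewrite big_ord_recr/= IH iterB -iterSr addrA subrK.
(* [V] commutes with the partial sums, hence with their limit *)
have WV x : V (w x) = w (V x).
  apply/esym/w_eq; rewrite (_ : s _ = V \o s x).
    apply: continuous_cvg (sw x).
    apply: (@bounded_continuous _ _ _ (b * r)) => y.
    by have := Vb 1%N y; rewrite expr1.
  apply/funext => n; rewrite /s /= linear_sum; apply: eq_bigr => k _.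
  by rewrite -iterS iterSr.
exists W; split=> [|x|x].
- exact: (@bounded_continuous R X W _ wb).
- exact: Wl.
- by rewrite /= WV -(raddfB W) /= Wl.
Qed.

Variable T : {linear X -> X}.

Lemma outside_resolvent M0 lambda :
  (forall n x, rnorm (iter n T x) <= M0 * rnorm x) ->
  1 < rnorm lambda -> resolvent_set T lambda.
Proof.
move=> Tb l1.
have l0 : lambda != 0 by rewrite -rnorm_gt0; lra.
pose V : {linear X -> X} := lambda^-1 \*: T.
have VE k x : iter k V x = lambda^-1 ^+ k *: iter k T x.
  elim: k x => [|k IH] x; first by rewrite expr0 scale1r.
  by rewrite iterS IH /V /= linearZ scalerA exprS.
have [||W [Wc Wl Wr]] := @neumann_series V M0 (rnorm lambda)^-1.
- by rewrite invr_ge0 rnorm_ge0 invf_lt1//; lra.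
- by move=> k x; rewrite VE rnormZ rnormX rnormV [M0 * _]mulrC -mulrA ler_wpM2l//
    ?exprn_ge0 ?invr_ge0 ?rnorm_ge0.
have TV x : lambda *: x - T x = lambda *: (x - V x).
  by rewrite scalerBr /V /= scalerA mulfV// scale1r.
exists (lambda^-1 \*: W : {linear X -> X}); split.
- by move=> x; apply: cvgZl_tmp; exact: Wc.
- by move=> x; rewrite TV /= linearZ scalerA mulVf// scale1r Wl.
- move=> x; rewrite TV.
  have VZ : V (lambda^-1 *: W x) = lambda^-1 *: V (W x) by exact: linearZ.
  rewrite -[LHS]/(lambda *: (lambda^-1 *: W x - V (lambda^-1 *: W x))) VZ.
  by rewrite -scalerBr Wr scalerA mulfV// scale1r.
Qed.

(** With [S = (mu - T)^-1], of norm at most [kappa], write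
    [lambda - T = (mu - T) (1 - (mu - lambda) S)]. *)
Lemma resolvent_open mu lambda kappa : resolvent_set T mu ->
  (forall x, rnorm x <= kappa * rnorm (mu *: x - T x)) ->
  0 <= kappa -> kappa * rnorm (mu - lambda) < 1 -> resolvent_set T lambda.
Proof.
move=> [S [Sc Sl Sr]] hk k0 kl.
have Sb x : rnorm (S x) <= kappa * rnorm x by rewrite -{2}(Sr x).
pose V : {linear X -> X} := (mu - lambda) \*: S.
have [||W [Wc Wl Wr]] := @neumann_series V 1 (kappa * rnorm (mu - lambda)).
- by rewrite kl mulr_ge0 ?rnorm_ge0.
- elim=> [|k IH] x; first by rewrite expr0 !mul1r.
  rewrite iterS /V /= rnormZ -/V exprS.
  have h := ler_wpM2l (rnorm_ge0 (mu - lambda)) (Sb (iter k V x)).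
  apply: le_trans h _; rewrite [leLHS]mulrCA [leLHS]mulrA.
  have kl0 : 0 <= kappa * rnorm (mu - lambda) by rewrite mulr_ge0 ?rnorm_ge0.
  apply: le_trans (ler_wpM2l kl0 (IH x)) _.
  by rewrite !mul1r [leLHS]mulrA.
have lE x : lambda *: x - T x = (mu *: x - T x) - (mu - lambda) *: x.
  by rewrite scalerBl opprB [RHS]addrC addrA subrK.
exists (W \o S : {linear X -> X}); split.
- by move=> x; apply: continuous_comp; [exact: Sc | exact: Wc].
- by move=> x; rewrite /= lE linearB Sl linearZ; exact: Wl.
- move=> x; rewrite lE /=; set u := W (S x).
  have Su : u - (mu - lambda) *: S u = S x by exact: Wr.
  have SrL (y z : X) : S y = S z -> y = z.
    by move=> E; rewrite -(Sr y) -(Sr z) E.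
  by apply: SrL; rewrite linearB Sl linearZ.
Qed.

Lemma resolvent_norm_le lambda kappa : resolvent_set T lambda ->
  (forall x, rnorm x <= kappa * rnorm (lambda *: x - T x)) -> 0 <= kappa ->
  (resolvent_norm T lambda <= kappa%:E)%E.
Proof.
move=> lT hk k0; rewrite /resolvent_norm asboolT//.
apply: le_opnorm => y y1; rewrite /resolvent.
have [S [_ _ Sr]] := lT.
case: xgetP => [x _ xE|/(_ (S y)) /= []]; last exact: Sr.
apply: le_trans (hk _) _; rewrite xE -[leRHS]mulr1.
by rewrite ler_wpM2l.
Qed.

End Resolvent.

(** * Scalar facts near the threshold *)

Section ScalarThreshold.
Variables (R : realType) (c : nat -> R[i]) (Q t0 l a : R) (N : nat).
Hypothesis c_A11 : A11 c.
Hypothesis Q_threshold : peripheral_threshold c Q.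
Hypothesis data : admissible c Q t0 l a N.

(** Otherwise [w] is constant, whereas [|w|] is at most [Q] on the powers of a
    point of [E_+] and above [Q] on the arc. *)
Lemma Lw_gt0 : 0 < Lw c.
Proof.
rewrite lt_neqAle Lw_ge0// andbT; apply/eqP => L0.
have ck k : (0 < k)%N -> c k = 0.
  move=> k0; apply/eqP; rewrite -rnorm_eq0.
  have := sum_le_Lw c_A11 k.+1; rewrite -L0 big_ord_recr /=.
  have S0 : 0 <= \sum_(i < k) i%:R * rnorm (c i).
    by apply: sumr_ge0 => i _; rewrite mulr_ge0 ?rnorm_ge0.
  have kR : 0 < k%:R :> R by rewrite ltr0n.
  have := rnorm_ge0 (c k) => n0 h.
  rewrite eq_le n0 andbT -(pmulr_rle0 _ kR); lra.
have ev z : Defs.eval c z = c 0%N.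
  rewrite /Defs.eval; apply: (@cvg_lim R[i]^o) => //; apply: cvg_near_cst.
  exists 1%N => // -[//|n] _ /=.
  rewrite big_ord_recl expr0 mulr1 big1 ?addr0// => i _.
  by rewrite ck// mul0r.
have [xi /(EsetP c_A11)[_ xiQ] _] := threshold_in_Eset c_A11 Q_threshold.
have := xiQ 1%N isT; rewrite ev.
case: data => /andP[l0 _] Qa harc _.
have := harc (expi (t0 + 0)); rewrite ev => h1 h2.
have : a <= rnorm (c 0%N).
  by apply: h1; exists 0 => //=; rewrite in_itv /= lexx ltW.
lra.
Qed.

Lemma Eminus_bound : exists2 b, b < Q & forall xi, Eminus c Q xi -> bw c xi <= b.
Proof.
have fin : finite_set (Eminus c Q).
  apply: sub_finite_set (Eset_finite c_A11 Q_threshold data).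
  by move=> xi [].
exists (\big[Num.max/0]_(xi <- fset_set (Eminus c Q)) bw c xi).
  rewrite big_seq_cond; apply: bigmax_lt; first exact: Q_gt0 Q_threshold.
  by move=> xi; rewrite andbT in_fset_set// inE => -[].
move=> xi xiE; apply: (le_bigmax_seq 0 xi xpredT (fun z => bw c z)) => //.
by rewrite in_fset_set// inE.
Qed.

(** The points of [E_+] are roots of unity, so that membership in [E(w, q)] is
    decided by [b_w], which takes no value strictly between
    [b] and [Q] on [E_+]. *)
Lemma Eset_below b q : (forall xi, Eminus c Q xi -> bw c xi <= b) ->
  b <= q < Q -> Eset c q = Eminus c Q.
Proof.
move=> hb /andP[bq qQ]; apply/seteqP; split=> xi.
  move=> xiq; split; first exact: Eset_le (ltW qQ) _ xiq.
  rewrite ltNge; apply/negP => /(maxpow_attained (Q_gt0 Q_threshold)).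
  move=> [n /andP[n1 _] Qn]; have [_ /(_ n n1)] := (EsetP c_A11 q xi).1 xiq.
  lra.
move=> xiE; have [/[dup] xiQ /(EsetP c_A11)[xi1 _] _] := xiE.
apply/(EsetP c_A11); split=> // n n1.
apply: le_trans (le_bw _ (Eset_root c_A11 Q_threshold data xiQ) n1) _.
exact: le_trans (hb _ xiE) bq.
Qed.

Lemma Cplus_ge M0 : 1 <= M0 -> 1 <= Cplus c Q M0 l a N.
Proof.
move=> M1; have M0_ge0 : 0 <= M0 by lra.
apply: (le_trans M1); rewrite /Cplus lerDl.
have := gap_const_gt0 data; rewrite /gap_const => g0.
by rewrite !mulr_ge0 ?addr_ge0 ?(Lw_ge0 c_A11)// ltW.
Qed.

Lemma dist_le (E : set R[i]) lambda xi : E xi -> dist lambda E <= rnorm (lambda - xi).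
Proof.
by move=> xiE; apply: ge_inf; [exists 0 => _ [z _ <-]; exact: rnorm_ge0|exists xi].
Qed.

Lemma dist_ge0 (E : set R[i]) lambda : 0 <= dist lambda E.
Proof.
have [->|/set0P[xi xiE]] := eqVneq E set0; first by rewrite /dist image_set0 inf0.
apply: lb_le_inf; first by exists (rnorm (lambda - xi)), xi.
by move=> _ [z _ <-]; exact: rnorm_ge0.
Qed.

End ScalarThreshold.

(** * Combining the two lower bounds *)

Section Balance.
Variable R : realFieldType.
Variables (e A C d x y : R).
Hypotheses (e_gt0 : 0 < e) (A_gt0 : 0 < A) (C_ge1 : 1 <= C).
Hypotheses (x_ge0 : 0 <= x) (y_ge0 : 0 <= y).
Hypothesis global : d * x <= C * y.

(** Below, [e] stands for [Q - q], [d] for the distance from [lambda] to a point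
    [xi] of [E_+], [x] and [y] for the norms of [x] and [lambda x - T x], and [D]
    for the distance from [lambda] to [E_-].  Here [xi] is itself in [E_-]. *)
Lemma balance_far D : e <= 2 * A -> D <= d -> D * x * e <= 6 * A * C * y.
Proof.
move=> eA Dd; move: global C_ge1 e_gt0 A_gt0 => gl C1 e0 A0.
have xe : 0 <= x * e by rewrite mulr_ge0// ltW.
have Cy : 0 <= C * y by rewrite mulr_ge0//; lra.
have := ler_wpM2r xe Dd; have := mulr_ge0 (ltW A0) Cy.
have := ler_wpM2r (ltW e0) gl; have := ler_wpM2l Cy eA; lra.
Qed.

Hypothesis local : d <= e / (2 * A) -> e * x <= 2 * A * y.

(** Where the local bound is not available, [d] is at least [e / (2 A)]. *)
Lemma balance_uniform : x * e <= 2 * A * C * y.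
Proof.
have A2 : 0 < 2 * A by rewrite mulr_gt0.
have Ay : 0 <= A * y by rewrite mulr_ge0// ltW.
move: global local C_ge1 => gl loc C1.
have [/loc near|] := leP d (e / (2 * A)).
  have := ler_wpM2r Ay C1; lra.
rewrite ltr_pdivrMr// => /ltW /(ler_wpM2l x_ge0) far.
have := ler_wpM2r (ltW A_gt0) gl; lra.
Qed.

(** The two summands of [2 + d] contribute [4 A C y], by [balance_uniform], and
    [2 A C y], by the global bound and [e <= 2 A]. *)
Lemma balance_weighted D : e <= 2 * A -> D <= 2 + d -> D * x * e <= 6 * A * C * y.
Proof.
move=> eA Dd; have A2 : 0 < 2 * A by rewrite mulr_gt0.
move: global local C_ge1 e_gt0 => gl loc C1 e0.
have xe : 0 <= x * e by rewrite mulr_ge0// ltW.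
have Ay : 0 <= A * y by rewrite mulr_ge0// ltW.
have Cy : 0 <= C * y by rewrite mulr_ge0//; lra.
have := ler_wpM2r xe Dd; have := balance_uniform.
have := ler_wpM2r (ltW e0) gl; have := ler_wpM2l Cy eA; lra.
Qed.

End Balance.

(** * Resolvent estimates *)

(** The constant [A] of the theorem. *)
Definition peak_const (R : realType) (c : nat -> R[i]) (Q M0 : R) : R :=
  M0 * Lw c * (max_ord (Eset c Q))%:R.

Section Estimates.
Variables (R : realType) (X : completeNormedModType R[i]).
Variables (c : nat -> R[i]) (Q t0 l a : R) (N : nat) (M0 q : R).
Variable T : {linear X -> X}.
Hypothesis c_A11 : A11 c.
Hypothesis Q_threshold : peripheral_threshold c Q.
Hypothesis data : admissible c Q t0 l a N.
Hypothesis M0_ge1 : 1 <= M0.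
Hypothesis T_bound : forall n x, rnorm (iter n T x) <= M0 * rnorm x.
Hypothesis wT_bound : forall n x, (1 <= n)%N ->
  rnorm (opeval c (iter n T) x) <= q * rnorm x.

Local Notation A := (peak_const c Q M0).
Local Notation C := (Cplus c Q M0 l a N).
Hypothesis q_lt : q < Q.
Hypothesis q_near : Q - q <= 2 * A.

Lemma peak_const_gt0 : 0 < A.
Proof.
have M0_gt0 : 0 < M0 by exact: lt_le_trans M0_ge1.
by rewrite /peak_const !mulr_gt0 ?(Lw_gt0 c_A11 Q_threshold data)// ltr0n
  (max_ord_gt0 c_A11 Q_threshold data).
Qed.

Let twoA_gt0 : 0 < 2 * A. Proof. exact: mulr_gt0 (ltr0Sn _ _) peak_const_gt0. Qed.

Let C_ge1 : 1 <= C. Proof. exact: (Cplus_ge c_A11 data M0_ge1). Qed.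

(** The radius [(Q - q) / 2A] lets the displacement from [xi] absorb half of the
    bound at [xi]. *)
Lemma near_peak_lower_bound lambda xi x : Eset c Q xi -> ~ Eminus c Q xi ->
  rnorm (lambda - xi) <= (Q - q) / (2 * A) ->
  (Q - q) * rnorm x <= 2 * A * rnorm (lambda *: x - T x).
Proof.
move=> xiE xiN; have A0 := peak_const_gt0.
have d0 : 0 < Q - q by rewrite subr_gt0.
rewrite ler_pdivlMr ?twoA_gt0// => hd.
have := threshold_point_lower_bound c_A11 M0_ge1 T_bound Q_threshold data
  wT_bound x xiE xiN; rewrite -/(peak_const c Q M0) => h.
have xE : rnorm (xi *: x - T x) <=
    rnorm (lambda *: x - T x) + rnorm (lambda - xi) * rnorm x.
  have -> : xi *: x - T x = (lambda *: x - T x) + (xi - lambda) *: x.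
    by rewrite scalerBl [RHS]addrC addrA subrK.
  by rewrite [rnorm (lambda - xi)]rnormB -rnormZ rnormD.
have := ler_wpM2l (ltW A0) xE; have := ler_wpM2r (rnorm_ge0 x) hd; lra.
Qed.

Lemma weighted_lower_bound lambda x : 1 <= rnorm lambda -> Eminus c Q !=set0 ->
  dist lambda (Eminus c Q) * rnorm x <=
  6 * A * C / (Q - q) * rnorm (lambda *: x - T x).
Proof.
move=> l1 [zeta zetaE]; have A0 := peak_const_gt0.
have d0 : 0 < Q - q by rewrite subr_gt0.
have [xi xiE h] := exterior_lower_bound c_A11 M0_ge1 T_bound Q_threshold data q_lt
  wT_bound l1.
rewrite mulrAC ler_pdivlMr//.
have [xiM|xiM] := pselect (Eminus c Q xi).
  exact: (balance_far d0 A0 C_ge1 (rnorm_ge0 x) (rnorm_ge0 _) (h x) q_near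
    (dist_le lambda xiM)).
apply: (balance_weighted d0 A0 C_ge1 (rnorm_ge0 x) (rnorm_ge0 _) (h x)
  (near_peak_lower_bound x xiE xiM) q_near).
(* two points of the unit circle are at distance at most 2 *)
apply: le_trans (dist_le lambda zetaE) _.
have -> : lambda - zeta = (xi - zeta) + (lambda - xi) by rewrite [RHS]addrC subrKA.
apply: le_trans (rnormD _ _) _; rewrite lerD2r.
apply: le_trans (rnormD _ _) _; rewrite rnormN.
have [xi1 _] := (EsetP c_A11 Q xi).1 xiE.
by have [zeta1 _] := (EsetP c_A11 Q zeta).1 zetaE.1; rewrite xi1 zeta1.
Qed.

Lemma uniform_lower_bound lambda x : 1 <= rnorm lambda -> Eminus c Q = set0 ->
  rnorm x <= 2 * A * C / (Q - q) * rnorm (lambda *: x - T x).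
Proof.
move=> l1 E0; have A0 := peak_const_gt0.
have d0 : 0 < Q - q by rewrite subr_gt0.
have [xi xiE h] := exterior_lower_bound c_A11 M0_ge1 T_bound Q_threshold data q_lt
  wT_bound l1.
have xiM : ~ Eminus c Q xi by rewrite E0.
rewrite mulrAC ler_pdivlMr//.
exact: (balance_uniform A0 C_ge1 (rnorm_ge0 x) (rnorm_ge0 _) (h x)
  (near_peak_lower_bound x xiE xiM)).
Qed.

Lemma KE_bound : Eminus c Q !=set0 ->
  (KE (Eminus c Q) T <= (6 * A * C / (Q - q))%:E)%E.
Proof.
move=> En; apply: ge_ereal_sup => _ [lambda /= l1 <-].
have lT := outside_resolvent T_bound l1.
have h x := weighted_lower_bound x (ltW l1) En.
have A0 := peak_const_gt0; have C1 := C_ge1.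
have B0 : 0 <= 6 * A * C / (Q - q).
  apply: divr_ge0; last by rewrite subr_ge0 ltW.
  by rewrite -mulrA mulr_ge0// (mulr_ge0 (ltW A0))//; lra.
have [->|dn0] := eqVneq (dist lambda (Eminus c Q)) 0.
  by rewrite mul0e lee_fin.
have d0 : 0 < dist lambda (Eminus c Q) by rewrite lt_def dn0 dist_ge0.
move: (6 * A * C / (Q - q)) h B0 => K h K0.
have -> : K = dist lambda (Eminus c Q) * (K / dist lambda (Eminus c Q)).
  by rewrite [RHS]mulrC divfK.
rewrite EFinM lee_pmul2l ?lte_fin//.
apply: (resolvent_norm_le lT) => [x|]; last by rewrite divr_ge0// ltW.
by rewrite mulrAC ler_pdivlMr// mulrC.
Qed.

Let kappa := 2 * A * C / (Q - q).

Let kappa_gt0 : 0 < kappa.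
Proof.
by rewrite divr_gt0 ?subr_gt0// (mulr_gt0 twoA_gt0)// (lt_le_trans ltr01 C_ge1).
Qed.

(** The uniform lower bound holds up to the circle, and a point of the circle is
    reached from [mu = (1 + e) lambda] when [e] is less than
    [1 / (kappa |lambda|)]. *)
Lemma exterior_resolvent lambda : 1 <= rnorm lambda -> Eminus c Q = set0 ->
  resolvent_set T lambda.
Proof.
move=> l1 E0; have k0 := kappa_gt0.
pose e := (kappa * rnorm lambda + 1)^-1.
have kl0 : 0 <= kappa * rnorm lambda by rewrite mulr_ge0 ?rnorm_ge0// ltW.
have e0 : 0 < e by rewrite invr_gt0; lra.
pose mu := (1 + e)%:C * lambda.
have mu1 : 1 < rnorm mu.
  rewrite rnormM rnormC gtr0_norm; last lra.
  have := ler_wpM2l (ltW e0) l1; lra.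
apply: (@resolvent_open R X T mu lambda kappa) => //.
- exact: outside_resolvent T_bound mu1.
- by move=> x; apply: uniform_lower_bound => //; exact: ltW.
- exact: ltW.
have -> : mu - lambda = e%:C * lambda.
  by rewrite /mu rmorphD rmorph1 mulrDl mul1r addrC addKr.
rewrite rnormM rnormC (gtr0_norm e0) mulrCA mulrC ltr_pdivrMr; lra.
Qed.

Lemma resolvent_bound : Eminus c Q = set0 ->
  (ereal_sup [set resolvent_norm T lambda
     | lambda in [set lambda : R[i] | (1 <= rnorm lambda)%R]] <= kappa%:E)%E.
Proof.
move=> E0; apply: ge_ereal_sup => _ [lambda /= l1 <-].
apply: resolvent_norm_le; [exact: exterior_resolvent| |exact: ltW].
by move=> x; exact: uniform_lower_bound.
Qed.

(** A point [lambda] of the annulus is within [1 - |lambda| < 1 / kappa] of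
    [lambda / |lambda|].  If the spectrum is empty, that is, on the zero space,
    the spectral radius is 0 and the bound amounts to [kappa >= 1]. *)
Lemma spectral_radius_bound : Eminus c Q = set0 ->
  spectral_radius T <= 1 - (Q - q) / (2 * A * C).
Proof.
move=> E0; have k0 := kappa_gt0.
have kV : (Q - q) / (2 * A * C) = kappa^-1 by rewrite /kappa invf_div.
have A0 := peak_const_gt0; have C1 := C_ge1; have qA := q_near.
have small : (Q - q) / (2 * A * C) <= 1.
  rewrite ler_pdivrMr; last by apply: mulr_gt0 => //; lra.
  have A2 : 0 <= 2 * A by lra.
  have := ler_wpM2l A2 C1; lra.
rewrite kV in small *.
have [S0|/set0P[s Ss]] := eqVneq (spectrum T) set0.
  by rewrite /spectral_radius S0 image_set0 sup0 subr_ge0.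
apply: ge_sup; first by exists (rnorm s), s.
move=> _ [lambda lS <-]; rewrite leNgt; apply/negP => hl; apply: lS.
have [l1|l1] := leP 1 (rnorm lambda); first exact: exterior_resolvent.
have l0 : 0 < rnorm lambda by apply: le_lt_trans hl; rewrite subr_ge0.
pose eta := lambda / (rnorm lambda)%:C.
have nr : rnorm ((rnorm lambda)%:C : R[i]) = rnorm lambda.
  by rewrite rnormC gtr0_norm.
have rC0 : (rnorm lambda)%:C != 0 :> R[i] by rewrite -rnorm_gt0 nr.
have eta1 : rnorm eta = 1 by rewrite rnormM rnormV nr mulfV// gt_eqF.
have etaE : eta - lambda = eta * (1 - rnorm lambda)%:C.
  by rewrite rmorphB rmorph1 mulrBr mulr1 divfK.
apply: (@resolvent_open R X T eta lambda kappa).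
- by apply: exterior_resolvent => //; rewrite eta1.
- by move=> x; apply: uniform_lower_bound => //; rewrite eta1.
- exact: ltW.
rewrite etaE rnormM eta1 mul1r rnormC gtr0_norm ?subr_gt0//.
by rewrite -ltr_pdivlMl// mulr1 ltrBlDr addrC -ltrBlDr.
Qed.

End Estimates.

Theorem theorem4p13 (R : realType) (c : nat -> R[i]) (Q M0 : R)
    (c_A11 : A11 c) (Q_threshold : peripheral_threshold c Q)
    (M0_ge1 : 1 <= M0) (t0 l a : R) (N : nat)
    (data : admissible c Q t0 l a N) :
  let A := M0 * Lw c * (max_ord (Eset c Q))%:R in
  let C := Cplus c Q M0 l a N in
  exists2 q0 : R, q0 < Q &
    (forall q : R, q0 <= q < Q -> Eset c q = Eminus c Q) /\
    forall (X : completeNormedModType R[i]) (T : {linear X -> X}) (q : R),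
      continuous T -> power_bounded T ->
      (power_sup T <= M0%:E)%E ->
      (ereal_sup [set opnorm (opeval c (iter n T)) | n in [set n | (1 <= n)%N]]
         <= q%:E)%E ->
      q0 <= q < Q ->
      (Eminus c Q !=set0 ->
         (KE (Eminus c Q) T <= (6 * A * C / (Q - q))%:E)%E) /\
      (Eminus c Q = set0 ->
         (ereal_sup [set resolvent_norm T lambda
                    | lambda in [set lambda : R[i] | (1 <= rnorm lambda)%R]]
            <= (2 * A * C / (Q - q))%:E)%E /\
         spectral_radius T <= 1 - (Q - q) / (2 * A * C)).
Proof.
move=> A C.
have A0 : 0 < A := peak_const_gt0 c_A11 Q_threshold data M0_ge1.
have [b bQ hb] := Eminus_bound c_A11 Q_threshold data.
(* [b] dominates [b_w] on [E_-]; [Q - 2 A] keeps the radius [(Q - q) / 2A] of the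
   local bound at most 1 *)
exists (Num.max b (Q - 2 * A)); first by rewrite gt_max bQ /=; lra.
split=> [q /andP[]|X T q _ _ TM wTq /andP[]]; rewrite ge_max => /andP[bq Aq] qQ.
  by apply: (Eset_below c_A11 Q_threshold data hb); rewrite bq.
have T_bound n x : rnorm (iter n T x) <= M0 * rnorm x.
  apply: opnorm_bound; first exact: iterZ.
  by apply: le_trans TM; apply: ereal_sup_ubound; exists n.
have wT_bound n x : (1 <= n)%N -> rnorm (opeval c (iter n T) x) <= q * rnorm x.
  move=> n1; apply: opnorm_bound; first exact: opevalZ c_A11 T_bound n.
  by apply: le_trans wTq; apply: ereal_sup_ubound; exists n.
have q_near : Q - q <= 2 * A by lra.
split=> [En|E0]; first exact: (KE_bound c_A11 Q_threshold data).
split; first exact: (resolvent_bound c_A11 Q_threshold data).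
exact: (spectral_radius_bound c_A11 Q_threshold data M0_ge1 T_bound wT_bound).
Qed.
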